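(* (i) For every $n \in \mathbb{N}$ there exists a complex polynomial $P_{2n}(z) = \sum_{k=0}^{2n} a_k z^k$ with $a_k \in \mathbb{C}\setminus\{0\}$ for all $k=0,1,\ldots,2n$ such that $|q_k(P_{2n})| = b_{2n}$ for all $k = 2, 3, \ldots, 2n$, and $P_{2n}$ has a multiple root. (ii) For every $n \in \mathbb{N}$ and every $\varepsilon > 0$ there exists a complex polynomial $P_{2n+1,\varepsilon}$ of degree $2n+1$ with all coefficients nonzero such that $|q_k(P_{2n+1,\varepsilon})| > b_{2n} - \varepsilon$ for all $k = 2, 3, \ldots, 2n+1$, and $P_{2n+1,\varepsilon}$ has a multiple root. (iii) For every $\varepsilon > 0$ there exists an entire function $f_\varepsilon(z)=\sum_{k=0}^\infty a_k(\varepsilon) z^k$ with $a_k(\varepsilon) \in \mathbb{C}\setminus\{0\}$ for all $k \ge 0$ such that $|q_k(f_\varepsilon)| > b_{\infty} - \varepsilon$ for all $k \geq 2$, and $f_\varepsilon$ has a multiple root.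
   Context: $\mathbb{N} = \{1, 2, 3, \ldots\}$. For a polynomial or entire function $f(z)=\sum_{k=0}^{\omega} a_k z^k$, $\omega \in \{2,3,4,\ldots\}\cup\{\infty\}$, with all coefficients $a_k \in \mathbb{C}\setminus\{0\}$, the second quotients of its coefficients are $q_k(f) = \dfrac{a_{k-1}^2}{a_{k-2}a_k}$ for $2 \le k \le \omega$ (for all $k\ge 2$ if $\omega=\infty$). For $n \in \mathbb{N}$, $b_{2n}$ denotes the unique positive root $x$ of the equation $1 - 2\sum_{k=1}^{n} x^{-k^2/2} = 0$ (e.g. $b_2 = 4$). $b_\infty$ denotes the unique root $x>1$ of the equation $1 - 2\sum_{k=1}^{\infty} x^{-k^2/2} = 0$ (the series converges for $x > 1$); numerically $b_\infty \approx 4.81058280$. *)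

(* Defs.v *)
From HB Require Import structures.
From mathcomp Require Export all_boot all_order all_algebra.
From mathcomp Require Export complex.
From mathcomp Require Export all_classical all_reals all_analysis.

Set Implicit Arguments.
Unset Strict Implicit.
Unset Printing Implicit Defensive.

Export Order.TTheory GRing.Theory Num.Theory.
Export numFieldNormedType.Exports.

Local Open Scope classical_set_scope.
Local Open Scope ring_scope.
Local Open Scope complex_scope.

(* [xget] picks an element of the set; for [1 <= n] the default [0] is never used, as in
   both cases below the root exists and is unique. The first sum decreases from
   [+oo] to [0] on [x > 0], and the series converges and does the same on
   [x > 1]. *)
Definition b_even (R : realType) (n : nat) : R :=
  xget 0 [set x : R |
    0 < x /\ 1 - 2 * \sum_(1 <= k < n.+1) x `^ (- (k ^ 2)%N%:R / 2) = 0].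

Definition b_infty (R : realType) : R :=
  xget 0 [set x : R |
    1 < x /\ 1 - 2 * \big[+%R/0]_(1 <= k <oo) x `^ (- (k ^ 2)%N%:R / 2) = 0].

(* Only meaningful for [2 <= k], where the subtractions are not truncated. *)
Definition second_quotient (F : fieldType) (a : nat -> F) (k : nat) : F :=
  a (k - 1)%N ^+ 2 / (a (k - 2)%N * a k).

Definition poly_has_multiple_root (F : fieldType) (p : {poly F}) : Prop :=
  exists z : F, (1 < mup z p)%N.

(* [^o] gives the field [R[i]] its normed topology, over itself, so that
   [derivable] and [derive1] are complex differentiability and the complex
   derivative. *)
Definition entire (R : realType) (f : R[i]^o -> R[i]^o) : Prop :=
  forall z, derivable f z 1.

Definition has_power_series (R : realType) (a : nat -> R[i])
    (f : R[i]^o -> R[i]^o) : Prop :=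
  forall z : R[i]^o,
    (fun m : nat => \sum_(0 <= k < m) a k * z ^+ k : R[i]^o) @ \oo --> f z.

Definition has_multiple_root (R : realType) (f : R[i]^o -> R[i]^o) : Prop :=
  exists z, f z = 0 /\ derive1 f z = 0.

(* Main.v *)
Require Import Defs.
From mathcomp Require Import ring lra zify.
Set Implicit Arguments.
Unset Strict Implicit.
Unset Printing Implicit Defensive.
Local Open Scope classical_set_scope.
Local Open Scope ring_scope.
Local Open Scope complex_scope.

(* Put t = b^(-1/2) with b = b_{2n}, so that 2 (t + t^4 + ... + t^(n^2)) = 1.
   The polynomial with coefficients 1 at z^n and -t^(j^2) at z^(n - j) and
   z^(n + j) has all |q_k| = t^(-2) = b, and by the choice of t it equals
   - sum_j t^(j^2) z^(n - j) (z^j - 1)^2, hence is (z - 1)^2 Q(z). For (ii) and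
   (iii) replace Q by Q + d with d small and supported from degree 2n - 1 on:
   the double root at 1 stays, the old quotients move by little, and the new
   ones tend to infinity. In (ii) d is the monomial x z^(2n - 1); in (iii) it is
   the entire function sum_j x^(j^2) z^(2n - 2 + j), with x -> 0+, where n is so
   large that t^(-2) > b_infty - eps. *)

(** * Convergence of complex sequences and series *)

Lemma normc_real (R : realType) (x : R) : `|x%:C| = `|x|%:C.
Proof. by rewrite normc_def /= expr0n addr0 sqrtr_sqr. Qed.

Lemma cvg_complex (R : realType) (x y : nat -> R) (a b : R) :
  x @ \oo --> a -> y @ \oo --> b ->
  (fun m => (x m +i* y m) : R[i]^o) @ \oo --> (a +i* b : R[i]^o).
Proof.
move=> /cvgrPdist_lt xa /cvgrPdist_lt yb; apply/cvgrPdist_lt => -[e e'] /=.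
rewrite ltcE /= => /andP[/eqP -> e0].
have e20 : 0 < e / 2 by rewrite divr_gt0.
near=> m.
have h1 : `|a - x m| < e / 2 by near: m; exact: xa.
have h2 : `|b - y m| < e / 2 by near: m; exact: yb.
have -> : (a +i* b) - (x m +i* y m) = (a - x m)%:C + 'i * (b - y m)%:C.
  by apply/eqP; rewrite eq_complex /=; apply/andP; split; apply/eqP; ring.
apply: (le_lt_trans (ler_normD _ _)).
rewrite normrM !normc_real (_ : `|'i| = 1) ?mul1r; last first.
  by rewrite normc_def /= expr0n expr1n add0r sqrtr1.
by rewrite -rmorphD /= ltcR; lra.
Unshelve. all: by end_near.
Qed.

(** The real and imaginary parts are each dominated by the same geometric series, so both converge
    absolutely. *)
Lemma cvg_complex_series (R : realType) (u : nat -> R[i]) (C : R) :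
  (forall k, `|u k| <= (C * 2^-1 ^+ k)%:C) ->
  exists l : R[i]^o, (fun m => \sum_(0 <= k < m) u k : R[i]^o) @ \oo --> l.
Proof.
move=> uC.
have dom (w : nat -> R) : (forall k, `|w k| <= C * 2^-1 ^+ k) -> cvgn (series w).
  move=> wC; apply: (@normed_cvg R R^o).
  apply: (@series_le_cvg _ _ (geometric C 2^-1)) => //.
  - by move=> n; exact: normr_ge0.
  - by move=> n; exact: le_trans (normr_ge0 _) (wC n).
  - by apply: is_cvg_geometric_series; rewrite ger0_norm ?invf_lt1 ?ltr1n.
have /dom cR : forall k, `|complex.Re (u k)| <= C * 2^-1 ^+ k.
  by move=> k; rewrite -lecR; apply: (le_trans _ (uC k)); exact: normc_ge_Re.
have /dom cI : forall k, `|complex.Im (u k)| <= C * 2^-1 ^+ k.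
  move=> k; rewrite -lecR; apply: (le_trans _ (uC k)).
  rewrite -normrN -ReiNIm (le_trans (normc_ge_Re _))// normrM (_ : `|'i%C| = 1) ?mulr1 //.
  by rewrite normc_def /= expr0n expr1n add0r sqrtr1.
exists (limn (series (fun k => complex.Re (u k))) +i* limn (series (fun k => complex.Im (u k)))).
rewrite (_ : (fun m => _) = fun m => series (fun k => complex.Re (u k)) m +i*
  series (fun k => complex.Im (u k)) m); first exact: cvg_complex.
apply/funext => m.
rewrite /series /=; elim: m => [|m IH]; first by rewrite !big_geq.
by rewrite !big_nat_recr //= IH; case: (u m).
Qed.

Lemma norm_cvg_le (R : realType) (u : nat -> R[i]^o) (l : R[i]^o) (M : R) :
  u @ \oo --> l -> (forall m, `|u m| <= M%:C) -> `|l| <= M%:C.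
Proof.
move=> /cvgrPdist_lt ul uM.
(* The order on [R[i]] is only partial, so the negation is taken between real numbers. *)
rewrite normc_def lecR leNgt; apply/negP; rewrite -ltcR -normc_def -subr_gt0.
move=> /ul[N _ /(_ N (leqnn N))] /=; rewrite ltrBDr => h.
have : `|l| < `|l|.
  apply: le_lt_trans (_ : `|l - u N| + `|u N| < _).
    by rewrite -[X in `|X| <= _](subrK (u N)); exact: ler_normD.
  by apply: le_lt_trans h; rewrite lerD2l.
by rewrite ltxx.
Qed.

(** * Power series with rapidly decreasing coefficients are entire *)

(** The error E_k satisfies E_{k+1} = (z + h) E_k + h^2 k z^(k-1). The factor 2^k absorbs k, and the
    bound is uniform on a disc, so it can be summed against the coefficients of a power series. *)
Lemma exprD_taylor1 (F : numFieldType) (z h rho : F) (k : nat) :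
  1 <= rho -> `|z| <= rho -> `|z + h| <= rho ->
  `|(z + h) ^+ k - z ^+ k - h * (k%:R * z ^+ k.-1)| <= `|h| ^+ 2 * (2 * rho) ^+ k.
Proof.
move=> r1 zr zhr; have r0 : 0 <= rho by apply: le_trans r1.
elim: k => [|k IH].
  by rewrite !expr0 mul0r mulr0 subrr subr0 normr0 mulr1 exprn_ge0.
have -> : (z + h) ^+ k.+1 - z ^+ k.+1 - h * (k.+1%:R * z ^+ k) =
   (z + h) * ((z + h) ^+ k - z ^+ k - h * (k%:R * z ^+ k.-1)) + h ^+ 2 * (k%:R * z ^+ k.-1).
  by case: k {IH} => [|k]; rewrite ?expr0 ?exprS /=; ring.
apply: (le_trans (ler_normD _ _)); rewrite !normrM !normrX normr_nat.
rewrite [(2 * rho) ^+ _]exprS.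
apply: (@le_trans _ _ (rho * (`|h| ^+ 2 * (2 * rho) ^+ k) + `|h| ^+ 2 * (rho * (2 * rho) ^+ k))).
  apply: lerD; first by apply: ler_pM.
  apply: ler_wpM2l; first exact: mulr_ge0.
  rewrite -[leLHS]mul1r; apply: ler_pM => //.
  rewrite exprMn; apply: ler_pM; rewrite ?ler0n ?exprn_ge0 //.
    by rewrite -natrX ler_nat ltnW // ltn_expl.
  case: k {IH} => [|k]; first by rewrite expr0.
  rewrite exprS -[leLHS]mul1r; apply: ler_pM; rewrite ?exprn_ge0 //.
  by apply: lerXn2r.
by rewrite le_eqVlt; apply/orP; left; apply/eqP; ring.
Qed.

(** The difference quotient differs from [d] by at most [M * |h|], which tends to 0. *)
Lemma derivable_quadratic (F : numFieldType) (f : F^o -> F^o) (z d M : F) :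
  (forall h : F, `|h| <= 1 -> `|f (z + h) - f z - h * d| <= M * `|h| ^+ 2) ->
  derivable f z 1.
Proof.
move=> fM; apply: (@cvgP _ _ d); apply/cvgrPdist_lt => e e0.
(* The hypothesis at [h = 1] forces this; [M + 1] then serves as a positive divisor. *)
have M0 : 0 <= M.
  have := fM 1; rewrite normr1 lexx expr1n mulr1 => /(_ isT); exact: le_trans.
have M1 : 0 < M + 1 by rewrite ltr_wpDl.
near=> h.
have h0 : h != 0 by near: h; exact: nbhs_dnbhs_neq.
have h1 : `|h| <= 1.
  by near: h; apply: dnbhs0_le.
have he : `|h| < e / (M + 1).
  by near: h; apply: dnbhs0_lt; rewrite divr_gt0.
rewrite /= [X in f (X + z)](_ : _ = h); last exact: mulr1.
have -> : d - h^-1 *: (f (h + z) - f z) = - (h^-1 * (f (z + h) - f z - h * d)).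
  rewrite (addrC h z).
  have E (a b c : F) : c - h^-1 * (a - b) = - (h^-1 * (a - b - h * c)) by field.
  exact: E.
rewrite normrN normrM normfV.
rewrite mulrC ltr_pdivrMr ?normr_gt0 //; apply: (le_lt_trans (fM _ h1)).
rewrite expr2 mulrA ltr_pM2r ?normr_gt0 //.
apply: (@le_lt_trans _ _ ((M + 1) * `|h|)); first by rewrite ler_wpM2r // lerDl.
by rewrite mulrC -ltr_pdivlMr.
Unshelve. all: by end_near.
Qed.

Lemma sum_half_le2 (F : numFieldType) (m : nat) :
  \sum_(0 <= k < m) (2^-1 : F) ^+ k <= 2.
Proof.
suff -> : \sum_(0 <= k < m) (2^-1 : F) ^+ k = 2 - 2 * 2^-1 ^+ m.
  by rewrite gerBl mulr_ge0 // exprn_ge0 // invr_ge0.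
elim: m => [|m IH]; first by rewrite big_geq // expr0 mulr1 subrr.
by rewrite big_nat_recr //= IH exprS; field.
Qed.

(** The termwise derivative converges to some [d], and summing the errors of [exprD_taylor1] gives
    the quadratic estimate that [derivable_quadratic] asks for. *)
Lemma entire_power_series (R : realType) (e : nat -> R[i]) :
  (forall r : R, 0 < r -> exists C : R, forall k, `|e k| * r%:C ^+ k <= C%:C) ->
  exists H, entire H /\ has_power_series e H.
Proof.
move=> eC.
have realnorm (z : R[i]) : exists r : R, `|z| = r%:C by rewrite normc_def; eexists.
have radius (z : R[i]) : exists rho C : R, [/\ 1 <= rho%:C :> R[i], `|z| + 1 <= rho%:C &
    forall k, `|e k| * (2 * rho%:C) ^+ k <= (C * 2^-1 ^+ k)%:C].
  have [r zr] := realnorm z.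
  have r0 : 0 <= r by rewrite -lecR -zr; exact: normr_ge0.
  (* With rho = r + 1, the radius 2 rho is the one in [exprD_taylor1]; a further factor 2 produces
     the ratio 1/2. *)
  have [] := eC (4 * (r + 1)); first by rewrite mulr_gt0 // ltr_wpDl.
  move=> C CP; exists (r + 1), C; split.
  - by rewrite rmorphD /= lerDr lecR.
  - by rewrite zr rmorphD.
  move=> k; rewrite rmorphM /=; apply: (le_trans _ (ler_wpM2r _ (CP k))); last first.
    by rewrite lecR exprn_ge0 // invr_ge0.
  rewrite rmorphXn -mulrA -exprMn -rmorphM (_ : 4 * (r + 1) / 2 = 2 * (r + 1)).
    by rewrite rmorphM /= rmorph_nat.
  by field.
have dom (rho C : R) (w : nat -> R[i]) : 
    (forall k, `|e k| * (2 * rho%:C) ^+ k <= (C * 2^-1 ^+ k)%:C) ->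
    (forall k, `|w k| <= (2 * rho%:C) ^+ k) ->
  exists l : R[i]^o, (fun m => \sum_(0 <= k < m) (e k * w k) : R[i]^o) @ \oo --> l.
  move=> CP wP; apply: (@cvg_complex_series _ _ C) => k.
  by apply: (le_trans _ (CP k)); rewrite normrM ler_wpM2l.
have powle (rho z : R[i]) k : 1 <= rho -> `|z| <= rho -> `|z ^+ k| <= (2 * rho) ^+ k.
  move=> r1 zr; rewrite normrX; apply: lerXn2r; rewrite ?nnegrE //.
    by rewrite mulr_ge0 // (le_trans _ r1).
  by rewrite (le_trans zr) // mulr_natl mulr2n lerDr (le_trans _ r1).
have /choice[H HP] : forall z : R[i]^o, exists l : R[i]^o,
    (fun m => \sum_(0 <= k < m) (e k * z ^+ k) : R[i]^o) @ \oo --> l.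
  move=> z; have [rho [C [r1 zr CP]]] := radius z.
  apply: (dom rho C) => // k; apply: powle => //.
  by rewrite (le_trans _ zr) // lerDl.
exists H; split; last exact: HP.
move=> z.
have [rho [C [r1 zr CP]]] := radius z.
have [d dP] : exists d : R[i]^o,
    (fun m => \sum_(0 <= k < m) (e k * (k%:R * z ^+ k.-1)) : R[i]^o) @ \oo --> d.
  apply: (dom rho C) => // k; rewrite normrM normr_nat exprMn.
  apply: ler_pM => //.
    by rewrite -natrX ler_nat ltnW // ltn_expl.
  have zr' : `|z| <= rho%:C by rewrite (le_trans _ zr) // lerDl.
  case: k => [|k]; first by rewrite /= !expr0 normr1.
  rewrite normrX exprS -[leLHS]mul1r; apply: ler_pM => //.
  by apply: lerXn2r => //; rewrite nnegrE (le_trans _ r1).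
apply: (@derivable_quadratic _ _ _ d (2 * C)%:C) => h h1.
have [s hs] := realnorm h.
rewrite hs -rmorphXn -rmorphM.
(* It suffices to bound the partial sums, which combine term by term into Taylor errors. *)
apply: (norm_cvg_le (cvgB (cvgB (HP (z + h)) (HP z)) (cvgM (cvg_cst (h : R[i]^o)) dP))) => m.
rewrite !fctE /= mulr_sumr -!sumrB.
apply: (le_trans (ler_norm_sum _ _ _)).
apply: (@le_trans _ _ (\sum_(0 <= k < m) ((s ^+ 2 * C)%:C * 2^-1 ^+ k))).
  apply: ler_sum => k _.
  rewrite (_ : _ - _ = e k * ((z + h) ^+ k - z ^+ k - h * (k%:R * z ^+ k.-1))); last by ring.
  rewrite normrM.
  apply: (le_trans (ler_wpM2l (normr_ge0 _) (exprD_taylor1 (rho := rho%:C) _ _ _ _))) => //.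
  - by rewrite (le_trans _ zr) // lerDl.
  - by rewrite (le_trans _ zr) // (le_trans (ler_normD _ _)) // lerD2l.
  rewrite hs mulrCA rmorphM rmorphXn -[leRHS]mulrA ler_wpM2l //.
    by rewrite -hs exprn_ge0.
  by apply: (le_trans (CP k)); rewrite rmorphM /= rmorphXn fmorphV rmorph_nat.
rewrite -mulr_sumr; apply: (le_trans (ler_wpM2l _ (sum_half_le2 _ _))).
  rewrite rmorphM mulr_ge0 //; first by rewrite rmorphXn /= -hs exprn_ge0.
  by have := CP 0%N; rewrite expr0 mulr1 mulr1; apply: le_trans.
rewrite -(rmorph_nat (real_complex R)) -rmorphM le_eqVlt; apply/orP; left; apply/eqP.
by congr _%:C; ring.
Qed.

(** * Multiplication by z - 1 and the double root at 1 *)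

(* Multiplication of a power series by [z - 1], on coefficients. *)
Definition mul_Xsub1 (F : pzRingType) (a : nat -> F) (k : nat) : F :=
  (if k is j.+1 then a j else 0) - a k.

Lemma has_power_series_mul_Xsub1 (R : realType) (a : nat -> R[i]) f :
  has_power_series a f -> has_power_series (mul_Xsub1 a) (fun z => (z - 1) * f z).
Proof.
move=> af z.
(* The partial sum of length m + 1 of the product is z times the one of length m of [f], minus the
   one of length m + 1. *)
rewrite -[_ @ \oo --> _]cvg_shiftS mulrBl mul1r.
rewrite [X in X @ _](_ : _ = (fun m => z * \sum_(0 <= k < m) a k * z ^+ k
    - \sum_(0 <= k < m.+1) a k * z ^+ k)).
  have afS := af z; rewrite -[_ @ \oo --> _]cvg_shiftS in afS.
  exact: (cvgB (cvgM (cvg_cst (z : R[i]^o)) (af z)) afS).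
apply/funext => m; rewrite [LHS]big_nat_recl // [X in _ - X]big_nat_recl //.
rewrite /mul_Xsub1 sub0r mulNr opprD [RHS]addrCA; congr (_ + _).
rewrite mulr_sumr -sumrB; apply: eq_bigr => k _.
by rewrite mulrBl exprS; congr (_ - _); rewrite mulrCA.
Qed.

Lemma coef_XsubC1_mul (F : nzRingType) (p : {poly F}) k :
  (('X - 1) * p)`_k = mul_Xsub1 (fun j => p`_j) k.
Proof. by rewrite mulrBl mul1r coefB coefXM /mul_Xsub1; case: k. Qed.

(** By the product rule every term of the derivative of [g] keeps a factor [z - 1], so both [g] and
    its derivative vanish at 1. *)
Lemma entire_mul_sqr_Xsub1 (R : realType) (f : R[i]^o -> R[i]^o) : entire f ->
  let g := (fun z => (z - 1) * ((z - 1) * f z)) : R[i]^o -> R[i]^o in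
  entire g /\ has_multiple_root g.
Proof.
move=> fE g.
have dl z : is_derive (z : R[i]^o) 1 (fun z : R[i]^o => z - 1 : R[i]^o) 1.
  have := is_deriveB (is_derive_id (z : R[i]^o) 1) (is_derive_cst (1 : R[i]^o) z 1).
  by rewrite subr0.
have dg (z : R[i]^o) : is_derive z 1 g ((z - 1) *: ((z - 1) *: 'D_1 f z + f z *: (1 : R[i]^o))
    + ((z - 1) * f z) *: (1 : R[i]^o)).
  have df : is_derive z 1 f ('D_1 f z) by apply: derivableP; exact: fE.
  exact: (is_deriveM (dl z) (is_deriveM (dl z) df)).
split; first by move=> z; have [] := dg z.
exists 1; split; first by rewrite /g subrr !mul0r.
by rewrite derive1E; have [_ ->] := dg 1; rewrite subrr mul0r !scale0r addr0.
Qed.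

(** * The theta polynomial and its double root *)

(** For [t] = x^(-1/2) this is the sum in the equation defining [b_even]. *)
Definition theta_sum (F : nzRingType) (t : F) (n : nat) : F :=
  \sum_(1 <= k < n.+1) t ^+ (k ^ 2).

(* [(k - n) + (n - k)] is [|k - n|], as one of the truncated differences is 0. *)
Definition theta_coef (F : nzRingType) (t : F) (n k : nat) : F :=
  if k == n then 1 else - t ^+ (((k - n) + (n - k)) ^ 2).

Definition theta_poly (F : nzRingType) (t : F) (n : nat) : {poly F} :=
  \poly_(k < (2 * n).+1) theta_coef t n k.

(* When [2 * theta_sum t n = 1], the polynomial is
   [- \sum_(1 <= j <= n) t ^ (j ^ 2) X ^ (n - j) (X ^ j - 1) ^ 2]. *)
Lemma theta_poly_double_root (F : comNzRingType) (t : F) (n : nat) :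
  2 * theta_sum t n = 1 ->
  exists Q, theta_poly t n = ('X - 1) * (('X - 1) * Q).
Proof.
move=> tn.
(* From X^j - 1 = (X - 1)(1 + X + ... + X^(j-1)), squared. *)
exists (- \sum_(1 <= j < n.+1) (t ^+ (j ^ 2))%:P * 'X^(n - j) * (\sum_(i < j) 'X^i) ^+ 2).
transitivity (- \sum_(1 <= j < n.+1) (t ^+ (j ^ 2))%:P * ('X^(n - j) + 'X^(n + j) - 2 * 'X^n)).
  (* Split the coefficients into those below n, the middle one and those above n; reversing the
     first block pairs n - j with n + j. *)
  rewrite /theta_poly poly_def -(big_mkord xpredT (fun k => theta_coef t n k *: 'X^k)).
  rewrite (big_cat_nat (n := n)) //=; last by lia.
  rewrite big_nat_rev [X in _ + X]big_ltn; last by lia.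
  have -> : \sum_(n.+1 <= i < (2 * n).+1) theta_coef t n i *: 'X^i
      = \sum_(0 <= i < n) theta_coef t n (i + n.+1) *: 'X^(i + n.+1).
    by rewrite -[n.+1 in LHS]add0n big_addn; congr bigop; rewrite /index_iota; congr iota; lia.
  rewrite [in RHS]big_add1 /= (_ : theta_coef t n n = 1) ?scale1r; last by rewrite /theta_coef eqxx.
  (* The hypothesis on [t] distributes the middle monomial over the pairs. *)
  have XnE : 'X^n = (2 * \sum_(0 <= i < n) (t ^+ (i.+1 ^ 2))%:P) * 'X^n :> {poly F}.
    rewrite -rmorph_sum /=.
    rewrite -[\sum_(0 <= i < n) _](big_add1 _ _ 0 n.+1 xpredT (fun i => t ^+ (i ^ 2))).
    by rewrite -[2](rmorph_nat (@polyC F)) -rmorphM tn mul1r.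
  rewrite [in LHS]XnE mulr_sumr mulr_suml -!big_split -sumrN /= [LHS]big_nat_cond [RHS]big_nat_cond.
  apply: eq_bigr => j /andP[/andP[_ jn] _].
  rewrite /theta_coef !ifF; try by apply/eqP; lia.
  rewrite -!mul_polyC !rmorphN /= add0n.
  rewrite (_ : (n - j.+1 - n + (n - (n - j.+1)))%N = j.+1); last by lia.
  rewrite (_ : (j + n.+1 - n + (n - (j + n.+1)))%N = j.+1); last by lia.
  by rewrite (_ : (n + j.+1 = j + n.+1)%N); [ring|lia].
rewrite -!mulrN -!sumrN !mulr_sumr [LHS]big_nat_cond [RHS]big_nat_cond.
apply: eq_bigr => j /andP[/andP[_ jn] _].
rewrite (_ : 'X^(n + j) = 'X^(n - j) * 'X^j ^+ 2); last first.
  by rewrite -exprM -exprD; congr ('X^_); lia.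
rewrite (_ : 'X^n = 'X^(n - j) * 'X^j); last by rewrite -exprD; congr ('X^_); lia.
have := subrX1 ('X : {poly F}) j; move: (\sum_(i < j) _) => S /eqP.
by rewrite subr_eq => /eqP ->; ring.
Qed.

(** Intermediate values on [0, 1]: 2 [theta_sum] - 1 is -1 at 0 and 2n - 1 at 1. *)
Lemma theta_sum_root (R : rcfType) (n : nat) : (0 < n)%N ->
  exists2 t : R, 0 < t & 2 * theta_sum t n = 1.
Proof.
move=> n0; pose q : {poly R} := 2 * theta_sum 'X n - 1.
have qE x : q.[x] = 2 * theta_sum x n - 1.
  rewrite /q /theta_sum !hornerE horner_sum.
  by under eq_bigr do rewrite hornerXn.
have [||t /andP[t0 _]] := @poly_ivt _ q 0 1.
- exact: ler01.
- rewrite !qE /theta_sum; apply/andP; split.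
    rewrite big_nat_cond big1; first by lra.
    by move=> k /andP[/andP[k1 _] _]; rewrite expr0n expn_eq0; case: k k1.
  under eq_bigr do rewrite expr1n.
  rewrite big_const_nat subn1 iter_addr_0 /=.
  have : (1 : R) <= n%:R by rewrite ler1n.
  by lra.
rewrite rootE qE subr_eq0 => /eqP tn; exists t => //.
rewrite lt_neqAle t0 andbT; apply/eqP => t00; move: tn.
rewrite -t00 /theta_sum big_nat_cond big1 => [|k /andP[/andP[k1 _] _]].
  by move/eqP; rewrite mulr0 eq_sym oner_eq0.
by rewrite expr0n expn_eq0; case: k k1.
Qed.

(** The first summand alone grows by [u - s], and the others do not decrease. This increment,
    independent of [n], drives the comparison of roots in [b_infty_approx]. *)
Lemma theta_sum_le (R : realFieldType) (s u : R) (n : nat) : (0 < n)%N ->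
  0 <= s -> s <= u -> theta_sum s n + (u - s) <= theta_sum u n.
Proof.
case: n => // n _ s0 su; rewrite /theta_sum ![\sum_(1 <= k < n.+2) _]big_ltn // !expr1.
suff : \sum_(2 <= k < n.+2) s ^+ (k ^ 2) <= \sum_(2 <= k < n.+2) u ^+ (k ^ 2) by lra.
by apply: ler_sum => k _; apply: lerXn2r; rewrite ?nnegrE //; exact: le_trans su.
Qed.

Lemma theta_root_le_half (R : realFieldType) (t : R) (n : nat) : (0 < n)%N ->
  0 < t -> 2 * theta_sum t n = 1 -> t <= 2^-1.
Proof.
move=> n0 t0 tn; have := theta_sum_le n0 (lexx 0) (ltW t0).
have : 0 <= theta_sum (0 : R) n by apply: sumr_ge0 => k _; exact: exprn_ge0.
by lra.
Qed.

(** * The substitution x = t^(-2) and the numbers b_{2n} and b_infty *)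

Lemma powR_half_sqr (R : realType) (x : R) (k : nat) :
  x `^ (- (k ^ 2)%N%:R / 2) = (x `^ (- 2^-1)) ^+ (k ^ 2).
Proof. by rewrite mulNr mulrC -mulNr powRrM powR_mulrn // powR_ge0. Qed.

Lemma powR_Nhalf_expN2 (R : realType) (x : R) : 0 < x -> (x `^ (- 2^-1)) ^- 2 = x.
Proof.
move=> x0; rewrite -powR_mulrn ?powR_ge0 // -powRN -powRrM.
by rewrite (_ : - 2^-1 * - 2 = 1) ?powRr1 ?ltW //; field.
Qed.

Lemma expN2_powR_Nhalf (R : realType) (t : R) : 0 < t -> (t ^- 2) `^ (- 2^-1) = t.
Proof.
move=> t0; rewrite -powR_mulrn ?ltW // -powRN -powRrM.
by rewrite (_ : - 2 * - 2^-1 = 1) ?powRr1 ?ltW //; field.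
Qed.

Lemma b_evenE (R : realType) (n : nat) : (0 < n)%N ->
  exists t : R, [/\ 0 < t, 2 * theta_sum t n = 1 & b_even R n = t ^- 2].
Proof.
move=> n0; rewrite /b_even; case: xgetP => [x _ [x0 /eqP]|no].
  rewrite subr_eq0 => /eqP x1; exists (x `^ (- 2^-1)); split.
  - exact: powR_gt0.
  - by rewrite [RHS]x1; congr (_ * _); apply: eq_bigr => k _; rewrite powR_half_sqr.
  - by rewrite powR_Nhalf_expN2.
(* The default value of [xget] is excluded, since [t ^- 2] solves the equation. *)
have [t t0 tn] := theta_sum_root R n0.
case: (no (t ^- 2)); split; first by rewrite invr_gt0 exprn_gt0.
apply/eqP; rewrite subr_eq0 -[X in X == _]tn; apply/eqP; congr (_ * _).
by apply: eq_bigr => k _; rewrite powR_half_sqr expN2_powR_Nhalf.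
Qed.

(** At s = B^(-1/2), with B = b_infty, the full theta series is 1/2, so long truncations come close
    to 1/2. At a slightly larger u they exceed 1/2, hence their root [t] lies below u, and t^(-2) is
    above u^(-2), which is chosen in [B - eps, B). *)
Lemma b_infty_approx (R : realType) (eps : R) : 0 < eps ->
  exists n (t : R), [/\ (0 < n)%N, 0 < t, 2 * theta_sum t n = 1
    & b_infty R - eps < t ^- 2].
Proof.
move=> eps0; rewrite /b_infty; case: xgetP => [B _ [B1 /eqP]|_]; last first.
  (* Without a root, [b_infty R] would be the default value 0. *)
  have [//|t t0 t1] := @theta_sum_root R 1; exists 1%N, t; split=> //.
  by rewrite sub0r; apply: (@lt_trans _ _ 0); rewrite ?oppr_lt0 ?invr_gt0 ?exprn_gt0.
have B0 : 0 < B by exact: lt_trans B1.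
pose s := B `^ (- 2^-1); have s0 : 0 < s by exact: powR_gt0.
have s1 : s < 1.
  rewrite -(@ltr_pXn2r _ 2) ?nnegrE ?ler01 ?ltW // expr1n -[_ ^+ 2]invrK.
  by rewrite powR_Nhalf_expN2 // invf_lt1.
under eq_fun do under eq_bigr do rewrite powR_half_sqr.
rewrite -/s subr_eq0 => /eqP Bsum.
have cs : cvgn (series (fun k => s ^+ (k ^ 2))).
  apply: (@series_le_cvg _ _ (geometric 1 s)).
  - by move=> k; exact/exprn_ge0/ltW.
  - by move=> k; rewrite /= mul1r; exact/exprn_ge0/ltW.
  - move=> k; rewrite /= mul1r; apply: ler_wiXn2l; rewrite ?ltW //.
    by case: k => [|k]; rewrite // -mulnn leq_pmulr.
  - by apply: is_cvg_geometric_series; rewrite ger0_norm ?ltW.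
rewrite -(is_cvg_series_restrict 1) in cs.
(* The second entry keeps [y] positive when [eps] is large. *)
pose y := Num.max (B - eps) (B / 2).
have yB : y < B by rewrite gt_max; apply/andP; split; lra.
have y0 : 0 < y by rewrite lt_max; apply/orP; right; lra.
pose u := y `^ (- 2^-1); have u0 : 0 < u by exact: powR_gt0.
have su : s < u.
  rewrite -(@ltr_pXn2r _ 2) ?nnegrE ?ltW // -ltf_pV2 ?posrE ?exprn_gt0 //.
  by rewrite !powR_Nhalf_expN2.
have [N _ sN] : \forall n \near \oo, 2^-1 - (u - s) < \sum_(1 <= k < n) s ^+ (k ^ 2).
  apply: (cvgr_gt _ cs); move: Bsum; move: (limn _) => L; lra.
have n0 : (0 < N.+1)%N by [].
have [t t0 tn] := theta_sum_root R n0; exists N.+1, t; split=> //.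
apply: (@le_lt_trans _ _ y); first by rewrite le_max lexx.
rewrite -[y](powR_Nhalf_expN2 y0) -/u ltf_pV2 ?posrE ?exprn_gt0 //.
(* If u <= t, monotonicity from s to u to t would push the truncated sum at [t] above 1/2. *)
rewrite ltr_pXn2r ?nnegrE ?ltW // ltNge; apply/negP => ut.
have := theta_sum_le n0 (ltW s0) (ltW su); have := theta_sum_le n0 (ltW u0) ut.
by have := sN N.+2 (leqW (leqnSn N)); rewrite -/(theta_sum s N.+1); lra.
Qed.

(** * Second quotients of the theta polynomial and of its perturbations *)

Lemma mul_Xsub1_sqrSS (F : pzRingType) (a : nat -> F) k :
  mul_Xsub1 (mul_Xsub1 a) k.+2 = a k - 2 * a k.+1 + a k.+2.
Proof. by rewrite /mul_Xsub1 mulr_natl mulr2n !opprD opprK !addrA. Qed.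

Lemma mul_Xsub1_sqrD (F : pzRingType) (a b : nat -> F) k :
  mul_Xsub1 (mul_Xsub1 (fun j => a j + b j)) k =
  mul_Xsub1 (mul_Xsub1 a) k + mul_Xsub1 (mul_Xsub1 b) k.
Proof.
have D1 (x y : nat -> F) j :
    mul_Xsub1 (fun i => x i + y i) j = mul_Xsub1 x j + mul_Xsub1 y j.
  by case: j => [|j]; rewrite /mul_Xsub1 opprD ?sub0r ?add0r // addrACA.
by rewrite -D1; congr mul_Xsub1; apply/funext => j; exact: D1.
Qed.

Lemma coef_XsubC1_sqr_mul (F : nzRingType) (p : {poly F}) k :
  (('X - 1) * (('X - 1) * p))`_k = mul_Xsub1 (mul_Xsub1 (fun j => p`_j)) k.
Proof.
rewrite coef_XsubC1_mul; congr mul_Xsub1.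
by apply/funext => j; exact: coef_XsubC1_mul.
Qed.

Lemma coef_theta_poly (F : nzRingType) (t : F) (n k : nat) :
  (theta_poly t n)`_k = if (k <= 2 * n)%N then theta_coef t n k else 0.
Proof. by rewrite coef_poly ltnS. Qed.

Lemma normr_theta_coef (R : realDomainType) (t : R) (n k : nat) : 0 < t ->
  `|theta_coef t n k| = t ^+ (((k - n) + (n - k)) ^ 2).
Proof.
move=> t0; rewrite /theta_coef; case: eqP => [->|_].
  by rewrite subnn normr1 expr0.
by rewrite normrN ger0_norm // exprn_ge0 // ltW.
Qed.

Lemma theta_coef_neq0 (R : realDomainType) (t : R) (n k : nat) : 0 < t ->
  theta_coef t n k != 0.
Proof. by move=> t0; rewrite -normr_gt0 normr_theta_coef // exprn_gt0. Qed.

(** The exponents are squares of the distance to n, and squares have constant second difference 2: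
    m^2 + (m+2)^2 = 2 + 2 (m+1)^2 on either side of n, and 1 + 1 = 2 + 0 across it. *)
Lemma theta_coef_quotient (R : realDomainType) (t : R) (n k : nat) : 0 < t ->
  `|theta_coef t n k * theta_coef t n k.+2| = t ^+ 2 * theta_coef t n k.+1 ^+ 2.
Proof.
move=> t0; rewrite -[X in _ = _ * X]real_normK ?num_real // normrM !normr_theta_coef //.
rewrite -exprM -!exprD; congr (_ ^+ _).
have [kn|kn] := leqP k.+2 n.
  have [m ->] : exists m, n = (k.+2 + m)%N by exists (n - k.+2)%N; lia.
  rewrite (_ : (k - _ + _)%N = m.+2); last by lia.
  rewrite (_ : (k.+2 - _ + _)%N = m); last by lia.
  rewrite (_ : (k.+1 - _ + _)%N = m.+1); last by lia.
  by rewrite -!mulnn; lia.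
have [kn'|kn'] := leqP n k.
  have [m ->] : exists m, k = (n + m)%N by exists (k - n)%N; lia.
  rewrite (_ : (n + m - n + _)%N = m); last by lia.
  rewrite (_ : ((n + m).+2 - _ + _)%N = m.+2); last by lia.
  rewrite (_ : ((n + m).+1 - _ + _)%N = m.+1); last by lia.
  by rewrite -!mulnn; lia.
have -> : n = k.+1 by lia.
rewrite (_ : (k - k.+1 + _)%N = 1%N); last by lia.
rewrite (_ : (k.+2 - k.+1 + _)%N = 1%N); last by lia.
by rewrite (_ : (k.+1 - k.+1 + _)%N = 0%N) ?subnn.
Qed.

Lemma second_quotient_real (R : rcfType) (b : nat -> R[i]) (a : nat -> R) k :
  (forall j, b j = (a j)%:C) -> `|second_quotient b k| = `|second_quotient a k|%:C.
Proof.
move=> ba; rewrite /second_quotient !ba -rmorphXn -rmorphM -fmorph_div /=.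
by rewrite normc_def /= expr0n addr0 sqrtr_sqr.
Qed.

Lemma second_quotient_gt (R : realFieldType) (a : nat -> R) (c : R) k :
  a k != 0 -> a k.+2 != 0 -> c * `|a k * a k.+2| < a k.+1 ^+ 2 ->
  c < `|second_quotient a k.+2|.
Proof.
move=> a0 a2 ca; rewrite /second_quotient normrM normfV ltr_pdivlMr.
  by rewrite normrX real_normK ?num_real // !subSS subn0.
by rewrite normr_gt0 !subSS subn0 mulf_neq0.
Qed.

(** Finitely many strict inequalities that hold in the limit x -> 0 persist for small x. They are
    stated without division because the coefficient of index 2n + 1 tends to 0; in this form
    q_{2n+1} is covered too. *)
Lemma near_second_quotients (R : realType) (t c : R) (n : nat) (d : R -> nat -> R) :
  0 < t -> c < t ^- 2 -> (forall k, d x k @[x --> 0^'+] --> 0) ->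
  let a x k := (theta_poly t n)`_k + mul_Xsub1 (mul_Xsub1 (d x)) k in
  \forall x \near 0^'+, (forall k, (k <= 2 * n)%N -> a x k != 0) /\
    (forall k, (k < 2 * n)%N -> c * `|a x k * a x k.+2| < a x k.+1 ^+ 2).
Proof.
move=> t0 ct d0 a.
have D0 (e : R -> nat -> R) : (forall k, e x k @[x --> 0^'+] --> 0) ->
    forall k, mul_Xsub1 (e x) k @[x --> 0^'+] --> 0.
  move=> e0 [|k]; rewrite /mul_Xsub1 -[X in _ --> X](subr0 0).
    exact: (cvgB (cvg_cst _) (e0 _)).
  exact: (cvgB (e0 _) (e0 _)).
have ap k : a x k @[x --> 0^'+] --> (theta_poly t n)`_k.
  rewrite -[X in _ --> X]addr0; apply: cvgD; first exact: cvg_cst.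
  by apply: (D0) => j; exact: D0.
have nz : \forall x \near 0^'+, forall k : 'I_(2 * n).+1, a x k != 0.
  apply: filter_forall => k; apply: (cvgr_neq0 _ (ap k)).
  by rewrite coef_theta_poly -ltnS ltn_ord theta_coef_neq0.
have lt : \forall x \near 0^'+, forall k : 'I_(2 * n),
    c * `|a x k * a x k.+2| < a x k.+1 ^+ 2.
  apply: filter_forall => k.
  have cL : c * `|a x k * a x k.+2| @[x --> 0^'+] -->
      c * `|(theta_poly t n)`_k * (theta_poly t n)`_k.+2|.
    by apply: (cvgM (cvg_cst c)); apply: cvg_norm; apply: cvgM.
  have cR : a x k.+1 ^+ 2 @[x --> 0^'+] --> (theta_poly t n)`_k.+1 ^+ 2.
    exact: (cvgM (ap _) (ap _)).
  suff : c * `|(theta_poly t n)`_k * (theta_poly t n)`_k.+2| < (theta_poly t n)`_k.+1 ^+ 2.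
    rewrite -subr_gt0 => lim0; near=> x; rewrite -subr_gt0; near: x.
    exact: (cvgr_gt _ (cvgB cR cL)).
  rewrite !coef_theta_poly (ltn_ord k) (ltnW (ltn_ord k)).
  have pos : 0 < theta_coef t n k.+1 ^+ 2.
    by rewrite -real_normK ?num_real // exprn_gt0 // normr_gt0 theta_coef_neq0.
  (* The second case is k + 2 = 2n + 1, where the limit of the left side is 0. *)
  case: ifP => _; last by rewrite mulr0 normr0 mulr0.
  rewrite theta_coef_quotient // mulrA -[ltRHS]mul1r ltr_pM2r //.
  by rewrite -ltr_pdivlMr ?exprn_gt0 // div1r.
near=> x; split=> k kn.
  have nzx : forall k : 'I_(2 * n).+1, a x k != 0 by near: x.
  exact: (nzx (Ordinal (kn : (k < (2 * n).+1)%N))).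
have ltx : forall k : 'I_(2 * n), c * `|a x k * a x k.+2| < a x k.+1 ^+ 2 by near: x.
exact: (ltx (Ordinal kn)).
Unshelve. all: by end_near.
Qed.

(** * The polynomials of degrees 2n and 2n + 1 *)

Lemma size_of_coef (F : nzRingType) (p : {poly F}) m :
  p`_m != 0 -> (forall k, (m < k)%N -> p`_k = 0) -> size p = m.+1.
Proof.
move=> pm p0; apply/eqP; rewrite eqn_leq; apply/andP; split.
  exact/leq_sizeP.
by rewrite ltnNge; apply/negP => /leq_sizeP /(_ _ (leqnn m)) pm0; rewrite pm0 eqxx in pm.
Qed.

Lemma map_poly_multiple_root (R : rcfType) (Q : {poly R}) :
  ('X - 1) * (('X - 1) * Q) != 0 ->
  poly_has_multiple_root (map_poly (real_complex R) (('X - 1) * (('X - 1) * Q))).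
Proof.
move=> Q0; exists 1; rewrite mup_geq ?map_poly_eq0 //.
rewrite !rmorphM !rmorphB /= !map_polyX !rmorph1 mulrA -expr2.
exact: dvdp_mulr.
Qed.

Lemma exists_even_degree_multiple_root (R : realType) (n : nat) : (0 < n)%N ->
  exists P : {poly R[i]},
    [/\ size P = (2 * n).+1,
        forall k : nat, (k <= 2 * n)%N -> P`_k != 0,
        forall k : nat, (2 <= k <= 2 * n)%N ->
          `|second_quotient (fun j => P`_j) k| = (b_even R n)%:C
      & poly_has_multiple_root P].
Proof.
move=> n0; have [t [t0 tn bE]] := b_evenE R n0.
have [Q PQ] := theta_poly_double_root tn.
have P0 k : (k <= 2 * n)%N -> (theta_poly t n)`_k != 0.
  by move=> kn; rewrite coef_theta_poly kn theta_coef_neq0.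
have sP : size (theta_poly t n) = (2 * n).+1.
  by apply: size_of_coef => [|k kn]; rewrite ?P0 // coef_theta_poly leqNgt kn.
exists (map_poly (real_complex R) (theta_poly t n)); split.
- by rewrite size_map_poly.
- by move=> k /P0; rewrite coef_map fmorph_eq0.
- case=> [|[|k]] //= kn.
  rewrite (@second_quotient_real _ _ (fun j => (theta_poly t n)`_j)); last first.
    by move=> j; rewrite coef_map.
  rewrite bE /second_quotient !subSS !subn0 !coef_theta_poly /=.
  rewrite kn !ifT; try by lia.
  congr _%:C; rewrite normrM normfV theta_coef_quotient // normrX real_normK ?num_real //.
  by rewrite invfM mulrCA mulfV ?mulr1 // expf_neq0 // theta_coef_neq0.
- by rewrite PQ; apply: map_poly_multiple_root; rewrite -PQ -size_poly_eq0 sP.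
Qed.

Lemma exists_odd_degree_multiple_root (R : realType) (n : nat) (eps : R) : (0 < n)%N -> 0 < eps ->
  exists P : {poly R[i]},
    [/\ size P = (2 * n + 1).+1,
        forall k : nat, (k <= 2 * n + 1)%N -> P`_k != 0,
        forall k : nat, (2 <= k <= 2 * n + 1)%N ->
          (b_even R n - eps)%:C < `|second_quotient (fun j => P`_j) k|
      & poly_has_multiple_root P].
Proof.
move=> n0 eps0; have [t [t0 tn ->]] := b_evenE R n0.
have [Q PQ] := theta_poly_double_root tn.
have ct : t ^- 2 - eps < t ^- 2 by rewrite gtrBl.
(* The coefficients of x X^(2n-1); multiplied by (X - 1)^2 they reach degree 2n + 1 with leading
   coefficient x. *)
pose d (x : R) k := if k == (2 * n).-1 then x else 0.
have d0 k : d x k @[x --> 0^'+] --> 0.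
  rewrite /d; case: eqP => _; last exact: cvg_cst.
  by apply: (@cvg_at_right_filter _ _ idfun 0 0); exact: cvg_id.
near (0 : R)^'+ => x.
have x0 : 0 < x by near: x; exact: nbhs_right_gt.
pose S := ('X - 1) * (('X - 1) * (Q + x *: 'X^((2 * n).-1))).
have SE k : S`_k = (theta_poly t n)`_k + mul_Xsub1 (mul_Xsub1 (d x)) k.
  rewrite PQ !coef_XsubC1_sqr_mul -mul_Xsub1_sqrD; congr (mul_Xsub1 (mul_Xsub1 _) _).
  apply/funext => j; rewrite coefD coefZ coefXn /d.
  by case: eqP; rewrite ?mulr1 ?mulr0.
have [nz lt] : (forall k, (k <= 2 * n)%N -> S`_k != 0) /\
    (forall k, (k < 2 * n)%N -> (t ^- 2 - eps) * `|S`_k * S`_k.+2| < S`_k.+1 ^+ 2).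
  have : (forall k, (k <= 2 * n)%N -> (theta_poly t n)`_k + mul_Xsub1 (mul_Xsub1 (d x)) k != 0) /\
      (forall k, (k < 2 * n)%N -> (t ^- 2 - eps) *
         `|((theta_poly t n)`_k + mul_Xsub1 (mul_Xsub1 (d x)) k) *
           ((theta_poly t n)`_k.+2 + mul_Xsub1 (mul_Xsub1 (d x)) k.+2)| <
         ((theta_poly t n)`_k.+1 + mul_Xsub1 (mul_Xsub1 (d x)) k.+1) ^+ 2).
    by near: x; exact: near_second_quotients.
  by move=> [h1 h2]; split=> k kn; rewrite !SE; [exact: h1|exact: h2].
have [m nm] : exists m, n = m.+1 by exists n.-1; lia.
have Stop : S`_(2 * n).+1 = x.
  rewrite SE coef_theta_poly ltnn add0r nm (_ : (2 * m.+1).+1 = (2 * m).+3)%N; last by lia.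
  rewrite mul_Xsub1_sqrSS /d nm (_ : (2 * m.+1).-1 = (2 * m).+1)%N; last by lia.
  by rewrite eqxx !gtn_eqF ?mulr0 ?subr0 ?addr0.
have Sgt k : (2 * n + 1 < k)%N -> S`_k = 0.
  move=> kn; rewrite SE coef_theta_poly ifF ?add0r; last by apply/negP; lia.
  case: k kn => [|[|k]] kn; [lia..|].
  by rewrite mul_Xsub1_sqrSS /d !ifF ?mulr0 ?subr0 ?addr0 //; apply/eqP; lia.
have {}nz k : (k <= 2 * n + 1)%N -> S`_k != 0.
  by rewrite addn1 leq_eqVlt => /orP[/eqP ->|/nz //]; rewrite Stop gt_eqF.
have sS : size S = (2 * n + 1).+1 by apply: size_of_coef => //; exact: nz.
exists (map_poly (real_complex R) S); split.
- by rewrite size_map_poly.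
- by move=> k /nz; rewrite coef_map fmorph_eq0.
- case=> [|[|k]] //= kn; rewrite (@second_quotient_real _ _ (fun j => S`_j)); last first.
    by move=> j; rewrite coef_map.
  by rewrite ltcR; apply: second_quotient_gt; [apply: nz; lia| apply: nz; lia|apply: lt; lia].
- by apply: map_poly_multiple_root; rewrite -size_poly_eq0 sS.
Unshelve. all: by end_near.
Qed.

(** * Growth and second quotients of the Gaussian tail *)

Lemma bounded_of_near_le1 (R : realType) (e : nat -> R) (r : R) :
  (\forall k \near \oo, `|e k| * r ^+ k <= 1) -> 0 < r ->
  exists C : R, forall k, `|e k| * r ^+ k <= C.
Proof.
move=> [N _ eN] r0; exists (1 + \sum_(k < N) `|e k| * r ^+ k) => k.
have pos j : 0 <= `|e j| * r ^+ j by rewrite mulr_ge0 // exprn_ge0 // ltW.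
have [Nk|kN] := leqP N k.
  by rewrite (le_trans (eN _ Nk)) // lerDl sumr_ge0.
by rewrite (bigD1 (Ordinal kN)) //= addrCA lerDl addr_ge0 // sumr_ge0.
Qed.

(** For k = j + m with j >= m and s = max(1, r), the product is at most (x^j s^2)^j, and x^j s^2 <=
    1 once j is large. *)
Lemma near_gauss_small (R : realType) (x r : R) (m : nat) : 0 < x < 1 -> 0 < r ->
  \forall k \near \oo, x ^+ ((k - m) ^ 2) * r ^+ k <= 1.
Proof.
move=> /andP[x0 x1] r0; pose s := Num.max 1 r.
have s1 : 1 <= s by rewrite le_max lexx.
have s0 : 0 <= s by exact: le_trans s1.
have : \forall j \near \oo, x ^+ j <= s ^- 2.
  have : geometric 1 x @ \oo --> (0 : R) by apply: cvg_geometric; rewrite ger0_norm ?ltW.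
  move=> /cvgr_lt /(_ (s ^- 2)); rewrite invr_gt0 exprn_gt0 ?(lt_le_trans _ s1) // => /(_ isT).
  by apply: filterS => j; rewrite /= mul1r => /ltW.
move=> [J _ JP]; exists (J + m + m)%N => // k /= kJ.
have [j [-> jm jJ]] : exists j, [/\ k = (j + m)%N, (m <= j)%N & (J <= j)%N].
  by exists (k - m)%N; split; lia.
rewrite addnK -mulnn exprM.
apply: (@le_trans _ _ ((x ^+ j) ^+ j * (s ^+ 2) ^+ j)).
  apply: ler_wpM2l; first by rewrite !exprn_ge0 // ltW.
  apply: (@le_trans _ _ (s ^+ (j + m))).
    by apply: lerXn2r; rewrite ?nnegrE ?(ltW r0) // le_max lexx orbT.
  by rewrite -exprM; apply: ler_weXn2l => //; lia.
rewrite -exprMn; apply: exprn_ile1.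
  by rewrite mulr_ge0 // exprn_ge0 // ltW.
by rewrite -ler_pdivlMr ?exprn_gt0 ?(lt_le_trans _ s1) // div1r; exact: JP.
Qed.

(** Each Gaussian term is at most a quarter of the preceding one, so the first term dominates the
    second difference. *)
Lemma gauss_diff_bounds (R : realFieldType) (x : R) (j : nat) : 0 < x -> x <= 4^-1 ->
  let g := x ^+ (j ^ 2) - 2 * x ^+ (j.+1 ^ 2) + x ^+ (j.+2 ^ 2) in
  x ^+ (j ^ 2) / 2 <= g <= x ^+ (j ^ 2).
Proof.
move=> x0 x4 /=.
have x1 : x <= 1 by lra.
have step i : x ^+ (i.+1 ^ 2) <= 4^-1 * x ^+ (i ^ 2).
  apply: (@le_trans _ _ (x ^+ (i ^ 2).+1)).
    by apply: ler_wiXn2l; rewrite ?(ltW x0) // -!mulnn; lia.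
  by rewrite exprS ler_pM2r // exprn_gt0.
have p i : 0 < x ^+ i by rewrite exprn_gt0.
have := step j; have := step j.+1; have := p (j ^ 2)%N; have := p (j.+1 ^ 2)%N.
have := p (j.+2 ^ 2)%N; move: (x ^+ _) (x ^+ _) (x ^+ _) => A B C.
by move=> *; apply/andP; split; lra.
Qed.

(** Pure Gaussian terms have second quotient x^(-2), and the bounds between half and full size cost
    at most a factor 4. The entry [a 0] is only bounded: it is the junction with the theta
    polynomial. *)
Lemma gauss_tail_quotient (R : realFieldType) (c x : R) (a : nat -> R) :
  0 < x -> x <= 4^-1 -> `|c| * x < 4^-1 -> `|a 0| <= 1 ->
  (forall j, a j.+1 = x ^+ (j.+1 ^ 2) - 2 * x ^+ (j.+2 ^ 2) + x ^+ (j.+3 ^ 2)) ->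
  forall j, a j.+1 != 0 /\ c * `|a j * a j.+2| < a j.+1 ^+ 2.
Proof.
move=> x0 x4 cx a0 aE j.
have x1 : x <= 1 by lra.
have p i : 0 < x ^+ i by rewrite exprn_gt0.
have lo i : x ^+ (i.+1 ^ 2) / 2 <= a i.+1.
  by rewrite aE; have /andP[] := gauss_diff_bounds i.+1 x0 x4.
have hi i : `|a i| <= x ^+ (i ^ 2).
  case: i => [|i]; first by rewrite expr0.
  have := lo i; rewrite aE => lo_i; rewrite ger0_norm.
    by have /andP[] := gauss_diff_bounds i.+1 x0 x4.
  by apply: le_trans lo_i; rewrite divr_ge0 // ltW.
have pos : 0 < a j.+1 by apply: lt_le_trans (lo j); rewrite divr_gt0.
split; first by rewrite gt_eqF.
(* [c] may be negative, so it is replaced by its absolute value. *)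
apply: (@le_lt_trans _ _ (`|c| * (x ^+ (j ^ 2) * x ^+ (j.+2 ^ 2)))).
  rewrite normrM; apply: (@le_trans _ _ (`|c| * (`|a j| * `|a j.+2|))).
    by apply: ler_wpM2r; [rewrite mulr_ge0 | exact: ler_norm].
  by apply: ler_wpM2l => //; apply: ler_pM.
have -> : x ^+ (j ^ 2) * x ^+ (j.+2 ^ 2) = x * (x * (x ^+ (j.+1 ^ 2)) ^+ 2).
  by rewrite -exprD -exprM -!exprS; congr (_ ^+ _); rewrite -!mulnn; lia.
apply: (@lt_le_trans _ _ ((x ^+ (j.+1 ^ 2) / 2) ^+ 2)); last first.
  by apply: lerXn2r; rewrite ?nnegrE ?lo ?(ltW pos) // divr_ge0 // ltW.
rewrite [ltLHS]mulrA expr_div_n [X in _ < X]mulrC.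
(* One factor x is spent on |c| x < 1/4, the other on x <= 1. *)
apply: (@lt_le_trans _ _ (4^-1 * (x * (x ^+ (j.+1 ^ 2)) ^+ 2))).
  by rewrite ltr_pM2r // mulr_gt0 // exprn_gt0.
rewrite (_ : (2 ^+ 2)^-1 = 4^-1 :> R); last by congr (_^-1); ring.
by rewrite ler_pM2l // ler_piMl // exprn_ge0 // ltW.
Qed.

Lemma mul_Xsub1_real (R : rcfType) (a : nat -> R) k :
  mul_Xsub1 (fun j => (a j)%:C) k = (mul_Xsub1 a k)%:C.
Proof. by case: k => [|k]; rewrite /mul_Xsub1 rmorphB ?rmorph0. Qed.

Lemma gauss_tail_cvg0 (R : realType) (m k : nat) :
  (if (k <= m)%N then 0 else x ^+ ((k - m) ^ 2)) @[x --> (0 : R)^'+] --> (0 : R).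
Proof.
case: leqP => [_|mk]; first exact: cvg_cst.
apply: cvg_at_right_filter.
have : x ^+ ((k - m) ^ 2) @[x --> (0 : R)] --> (0 : R) ^+ ((k - m) ^ 2).
  exact: exprn_continuous.
by rewrite expr0n expn_eq0 subn_eq0 leqNgt mk.
Qed.

(** * The entire function *)

Lemma exists_entire_multiple_root (R : realType) (eps : R) : 0 < eps ->
  exists (a : nat -> R[i]) (f : R[i]^o -> R[i]^o),
    [/\ entire f /\ has_power_series a f,
        forall k : nat, a k != 0,
        forall k : nat, (2 <= k)%N ->
          (b_infty R - eps)%:C < `|second_quotient a k|
      & has_multiple_root f].
Proof.
move=> eps0; have [n [t [n0 t0 tn ct]]] := b_infty_approx eps0.
set c := b_infty R - eps in ct *.
have [Q PQ] := theta_poly_double_root tn.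
have [m nm] : exists m, (2 * n = m.+2)%N by exists (2 * n).-2; lia.
(* Here m = 2n - 2. For k <= m the power would be x^0 = 1, which does not tend to 0, so these
   entries are set to 0. *)
pose d (x : R) k := if (k <= m)%N then 0 else x ^+ ((k - m) ^ 2).
pose a x k := (theta_poly t n)`_k + mul_Xsub1 (mul_Xsub1 (d x)) k.
near (0 : R)^'+ => x.
have x0 : 0 < x by near: x; exact: nbhs_right_gt.
have x4 : x <= 4^-1 by near: x; apply: nbhs_right_le; rewrite invr_gt0.
have cx : `|c| * x < 4^-1.
  have c1 : 0 < `|c| + 1 by rewrite ltr_wpDl.
  have : x < 4^-1 / (`|c| + 1) by near: x; apply: nbhs_right_lt; rewrite divr_gt0.
  rewrite ltr_pdivlMr // => h; apply: le_lt_trans h.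
  by rewrite mulrC ler_pM2l // lerDl.
have [nz lt] : (forall k, (k <= 2 * n)%N -> a x k != 0) /\
    (forall k, (k < 2 * n)%N -> c * `|a x k * a x k.+2| < a x k.+1 ^+ 2).
  by near: x; apply: near_second_quotients => // k; exact: gauss_tail_cvg0.
have aS j : a x (2 * n + j.+1)%N =
    x ^+ (j.+1 ^ 2) - 2 * x ^+ (j.+2 ^ 2) + x ^+ (j.+3 ^ 2).
  rewrite /a coef_theta_poly ifF ?add0r; last by apply/negP; lia.
  rewrite nm (_ : (m.+2 + j.+1 = (m + j.+1).+2)%N) // mul_Xsub1_sqrSS /d.
  rewrite !ifF; try by apply/negP; lia.
  by congr (x ^+ (_ ^ 2) - 2 * x ^+ (_ ^ 2) + x ^+ (_ ^ 2)); lia.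
(* This coefficient is -t^(n^2) - 2x + x^4; both t^(n^2) and 2x - x^4 are at most 1/2. *)
have a0 : `|a x (2 * n + 0)%N| <= 1.
  rewrite addn0 /a coef_theta_poly leqnn.
  apply: (le_trans (ler_normD _ _)); rewrite normr_theta_coef //.
  have th : t ^+ ((2 * n - n + (n - 2 * n)) ^ 2) <= 2^-1.
    have th := theta_root_le_half n0 t0 tn.
    apply: (le_trans _ th); rewrite -[leRHS]expr1; apply: ler_wiXn2l; rewrite ?ltW //.
      by lra.
    by rewrite expn_gt0; apply/orP; left; lia.
  have : `|mul_Xsub1 (mul_Xsub1 (d x)) (2 * n)| <= 2^-1.
    rewrite nm mul_Xsub1_sqrSS /d leqnn ltnn ifF; last by apply/negP; lia.
    rewrite subSnn (_ : (m.+2 - m)%N = 2%N); last by lia.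
    have x4' : x ^+ (2 ^ 2) <= x by rewrite -[leRHS]expr1; apply: ler_wiXn2l; rewrite ?ltW //; lra.
    have x4'' : 0 <= x ^+ (2 ^ 2) by rewrite exprn_ge0 // ltW.
    by rewrite exp1n expr1 ler_norml; apply/andP; split; lra.
  by lra.
have tail := gauss_tail_quotient (a := fun j => a x (2 * n + j)%N) x0 x4 cx a0 aS.
have {}nz k : a x k != 0.
  have [/nz //|kn] := leqP k (2 * n).
  have [+ _] := tail (k - (2 * n).+1)%N.
  by rewrite (_ : (2 * n + _)%N = k) //; lia.
(* The limit x -> 0 handles q_2, ..., q_{2n+1}, and the Gaussian tail all later quotients. *)
have {}lt k : c * `|a x k * a x k.+2| < a x k.+1 ^+ 2.
  have [/lt //|kn] := ltnP k (2 * n).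
  have [_] := tail (k - 2 * n)%N.
  by rewrite !addnS subnKC.
(* The coefficients of the cofactor of (z - 1)^2. *)
pose e k := (Q`_k + d x k)%:C.
have eC r : 0 < r -> exists C, forall k, `|e k| * r%:C ^+ k <= C%:C.
  move=> r0; have [|C CP] := @bounded_of_near_le1 R (fun k => Q`_k + d x k) r _ r0.
    have x01 : 0 < x < 1 by rewrite x0 /=; lra.
    have [N _ NP] := near_gauss_small m x01 r0.
    exists (N + size Q + m.+1)%N => // k /= kN.
    rewrite nth_default ?add0r; last by lia.
    rewrite /d ifF; last by apply/negP; lia.
    by rewrite ger0_norm ?exprn_ge0 ?(ltW x0) //; apply: NP => /=; lia.
  exists C => k; rewrite /e normc_real -rmorphXn -rmorphM lecR.
  exact: CP.
have [H [HE Hs]] := entire_power_series eC.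
have [fE fR] := entire_mul_sqr_Xsub1 HE.
have DDe k : mul_Xsub1 (mul_Xsub1 e) k = (a x k)%:C.
  have -> : mul_Xsub1 e = fun j => (mul_Xsub1 (fun j => Q`_j + d x j) j)%:C.
    by apply/funext => j; rewrite mul_Xsub1_real.
  by rewrite mul_Xsub1_real mul_Xsub1_sqrD -coef_XsubC1_sqr_mul -PQ.
exists (mul_Xsub1 (mul_Xsub1 e)), (fun z => (z - 1) * ((z - 1) * H z)).
split; last exact: fR.
- split; first exact: fE.
  exact: has_power_series_mul_Xsub1 (has_power_series_mul_Xsub1 Hs).
- by move=> k; rewrite DDe fmorph_eq0; exact: nz.
- case=> [|[|k]] k2; [by []|by []|].
  by rewrite (second_quotient_real _ DDe) ltcR; exact: second_quotient_gt (nz _) (nz _) (lt _).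
Unshelve. all: by end_near.
Qed.

Theorem theorem1p3 (R : realType) :
  (forall n : nat, (1 <= n)%N ->
     exists P : {poly R[i]},
       [/\ size P = (2 * n).+1,
           forall k : nat, (k <= 2 * n)%N -> P`_k != 0,
           forall k : nat, (2 <= k <= 2 * n)%N ->
             `|second_quotient (fun j => P`_j) k| = (b_even R n)%:C
         & poly_has_multiple_root P])
  /\
  (forall (n : nat) (eps : R), (1 <= n)%N -> 0 < eps ->
     exists P : {poly R[i]},
       [/\ size P = (2 * n + 1).+1,
           forall k : nat, (k <= 2 * n + 1)%N -> P`_k != 0,
           forall k : nat, (2 <= k <= 2 * n + 1)%N ->
             (b_even R n - eps)%:C < `|second_quotient (fun j => P`_j) k|
         & poly_has_multiple_root P])
  /\
  (forall eps : R, 0 < eps ->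
     exists (a : nat -> R[i]) (f : R[i]^o -> R[i]^o),
       [/\ entire f /\ has_power_series a f,
           forall k : nat, a k != 0,
           forall k : nat, (2 <= k)%N ->
             (b_infty R - eps)%:C < `|second_quotient a k|
         & has_multiple_root f]).
Proof.
split; first by move=> n; exact: exists_even_degree_multiple_root.
split; first by move=> n eps; exact: exists_odd_degree_multiple_root.
by move=> eps; exact: exists_entire_multiple_root.
Qed.
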